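(* Let $(T_n)_{n\ge 1}$ be a uniform random recursive tree and let $R_n$ be the closeness rank of the root (vertex $1$) in $T_n$. Then $$\mathbb{E}R_n=\exp\left(\Omega\left((\log n)^{1/3}\right)\right),$$ i.e. there exist constants $c>0$ and $n_0$ such that $\mathbb{E}R_n\ge\exp\left(c(\log n)^{1/3}\right)$ for all $n\ge n_0$.
   Context: A uniform random recursive tree (URRT) is a random sequence of trees $(T_n)_{n\ge 1}$ with $V(T_n)=[n]=\{1,\ldots,n\}$: $T_1$ is the single vertex $1$ (the root), and $T_{n+1}$ is obtained from $T_n$ by adding vertex $n+1$ and an edge $\{i,n+1\}$, where $i$ is chosen uniformly at random from $[n]$, independently of the past. The closeness centrality of $v\in V(T_n)$ is $\mathcal{C}_{T_n}(v)=\sum_{u\in V(T_n)\setminus\{v\}}\mathrm{dist}(v,u)$, where $\mathrm{dist}(v,u)$ is the length of the path between $v$ and $u$ in $T_n$; smaller values correspond to more central vertices. Ranking: vertices are ordered from most to least central; vertices with equal centrality value are ordered in reverse order of insertion time (if $u,v$ have equal centrality, $u$ is ranked before $v$ iff $u>v$). This gives a permutation $\gamma_n$ of $[n]$, where $\gamma_n(v)\in\{1,\ldots,n\}$ is the position of $v$ in this order (position $1$ being most central). The rank of the root is $R_n=\gamma_n(1)$. *)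

(* Defs.v *)
From mathcomp Require Import all_boot all_order all_algebra.
From mathcomp Require Import all_classical all_reals all_analysis.

Set Implicit Arguments.
Unset Strict Implicit.
Unset Printing Implicit Defensive.

Import Order.TTheory GRing.Theory Num.Theory.

Local Open Scope classical_set_scope.
Local Open Scope ring_scope.

(* A graph on [n] = {1, ..., n} is given by its adjacency relation on nat;
   the vertex set [n] is [iota 1 n], with n passed separately. *)

Definition add_edge (e : rel nat) (i v : nat) : rel nat :=
  fun x y => [|| e x y, (x == i) && (y == v) | (x == v) && (y == i)].

(* In a tree there is exactly one simple path from u to v (listed without its
   initial vertex u), so the choice made by [xget] is forced. *)
Definition dist (e : rel nat) (u v : nat) : nat :=
  size (xget [::] [set p : seq nat | [/\ path e u p, last u p = v & uniq (u :: p)]]).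

Definition closeness (n : nat) (e : rel nat) (v : nat) : nat :=
  (\sum_(u <- iota 1%N n | u != v) dist e v u)%N.

(* Ties are broken in favour of the vertex inserted last. *)
Definition ranked_before (n : nat) (e : rel nat) : rel nat :=
  fun u v => (closeness n e u < closeness n e v)%N
          || (closeness n e u == closeness n e v) && (v <= u)%N.

Definition closeness_rank (n : nat) (e : rel nat) (v : nat) : nat :=
  (index v (sort (ranked_before n e) (iota 1%N n))).+1.

Section URRT.
Context {d : measure_display} {Omega : measurableType d} {R : realType}.

(* [I n] is the vertex to which n+1 is attached.  The trees T_1, ..., T_n take
   finitely many values, so independence of [I n] from (T_1, ..., T_n) is the
   product rule on the events {I n = k} and {T_1 = t_1, ..., T_n = t_n}.
   The value of [T 0] is irrelevant. *)
Definition is_URRT (P : probability Omega R) (T : nat -> Omega -> rel nat) : Prop :=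
  (forall w, T 1%N w =2 (fun _ _ => false)) /\
  exists I : nat -> Omega -> nat, forall n : nat, (0 < n)%N ->
    [/\ forall w, (1 <= I n w <= n)%N,
        forall k, measurable [set w | I n w = k],
        forall k, (1 <= k <= n)%N -> P [set w | I n w = k] = (n%:R^-1)%:E,
        forall (k : nat) (t : nat -> rel nat),
          let past := [set w | forall m, (1 <= m <= n)%N -> T m w =2 t m] in
          P ([set w | I n w = k] `&` past) = (P [set w | I n w = k] * P past)%E
      & forall w, T n.+1 w =2 add_edge (T n w) (I n w) n.+1].

Definition root_rank (T : nat -> Omega -> rel nat) (n : nat) : Omega -> R :=
  fun w => (closeness_rank n (T n w) 1%N)%:R.

End URRT.

(* Main.v *)
Require Import Defs.
From mathcomp Require Import all_boot all_order all_algebra.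
From mathcomp Require Import all_classical all_reals all_analysis.
From mathcomp Require Import measurable_realfun.
From mathcomp Require Import zify ring lra.

(* Put k = 2t + 1 and suppose that the tree starts as the path 1 - 2 - ... - k
   and that every vertex added until there are 16t of them is a descendant of k;
   this has probability at least (16t)^(-2t).  The proportion of vertices that
   are not descendants of k is then a martingale started at 1/8, so it is often
   at most 1/4, and in that case every descendant of k at distance t from k is
   at least as central as the root, which is at distance 2t from k.  The expected
   number of descendants at distance l obeys a Pascal-like recursion whenever the
   number of vertices doubles, hence is at least 'C(j, l) / 2^l after j doublings.
   With t of order (log n)^(1/3) and j of order t^3 the gain exceeds the
   probabilistic cost by a factor exponential in t. *)

Set Implicit Arguments.
Unset Strict Implicit.
Unset Printing Implicit Defensive.

Import Order.TTheory GRing.Theory Num.Theory.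
Local Open Scope classical_set_scope.
Local Open Scope ring_scope.

Local Arguments iota : simpl never.

Lemma iota1S n : iota 1 n.+1 = iota 1 n ++ [:: n.+1].
Proof. by rewrite -[X in iota 1 X]addn1 iotaD add1n. Qed.

(** * Recursive trees given by their list of parents *)

(* [s] lists the parents of the vertices [(size s).+1, ..., 2], newest first. *)
Fixpoint rtree (s : seq nat) : rel nat :=
  if s is i :: s' then add_edge (rtree s') i (size s').+2
  else fun _ _ => false.

Definition vertex (s : seq nat) : pred nat := fun v => (0 < v <= (size s).+1)%N.

Fixpoint rec_seq (s : seq nat) : bool :=
  if s is i :: s' then vertex s' i && rec_seq s' else true.

(** The newest vertex is a leaf, so its distances are read off at its parent and older distances do
    not change. A number never added as a new vertex behaves like the root, so symmetry and the
    triangle inequality hold on all of [nat]. *)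
Fixpoint rdist (s : seq nat) (u v : nat) : nat :=
  if s is i :: s' then
    let x := (size s').+2 in
    if u == x then if v == x then 0%N else (rdist s' i v).+1
    else if v == x then (rdist s' u i).+1 else rdist s' u v
  else 0%N.

Lemma vertex_cons i s v :
  vertex (i :: s) v = (v == (size s).+2) || vertex s v.
Proof. by rewrite /vertex /=; lia. Qed.

Lemma vertex_new s v : vertex s v -> (v == (size s).+2) = false.
Proof. by rewrite /vertex; lia. Qed.

Lemma rtree_sym s u v : rtree s u v = rtree s v u.
Proof.
elim: s => //= i s IHs.
rewrite /add_edge IHs; case: (rtree s v u) => //=.
by rewrite orbC [X in X || _]andbC [X in _ || X]andbC.
Qed.

Lemma rtree_vertexl s u v : rec_seq s -> rtree s u v -> vertex s u.
Proof.
elim: s => //= i s IHs /andP[vi rs]; rewrite vertex_cons.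
case/or3P => [e|/andP[/eqP-> _]|/andP[/eqP-> _]].
- by rewrite (IHs rs e) orbT.
- by rewrite vi orbT.
- by rewrite eqxx.
Qed.

Lemma rtree_vertexr s u v : rec_seq s -> rtree s u v -> vertex s v.
Proof. by rewrite rtree_sym; apply: rtree_vertexl. Qed.

Lemma rtree_new i s v : rec_seq (i :: s) ->
  rtree (i :: s) (size s).+2 v = (v == i).
Proof.
move=> /= /andP[vi rs]; rewrite /add_edge eqxx /= [_ == i]eq_sym (vertex_new vi).
case e: (rtree s _ v) => //=.
by have := rtree_vertexl rs e; rewrite /vertex ltnn andbF.
Qed.

Lemma rtree_old i s u v : u != (size s).+2 -> v != (size s).+2 ->
  rtree (i :: s) u v = rtree s u v.
Proof.
by move=> /negbTE u_old /negbTE v_old; rewrite /= /add_edge u_old v_old andbF !orbF.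
Qed.

Lemma path_rtree_old i s u p : (size s).+2 \notin u :: p ->
  path (rtree (i :: s)) u p = path (rtree s) u p.
Proof.
elim: p u => // v p IHp u.
rewrite !inE !negb_or => /and3P[nu nv np]; rewrite [LHS]/= [RHS]/= -IHp ?inE ?negb_or ?nv //.
by rewrite -(rtree_old i) // eq_sym.
Qed.

Lemma path_rtree_vertex s u p : rec_seq s -> path (rtree s) u p ->
  all (vertex s) p.
Proof.
move=> rs; elim: p u => //= v p IHp u /andP[/(rtree_vertexr rs)-> /=].
exact: IHp.
Qed.

(** Induction on the newest vertex: being a leaf, it can only be an endpoint of a simple path, and
    removing it leaves a path from or to its parent in the older tree. *)
Lemma rtree_path_size s u p : rec_seq s -> vertex s u ->
  path (rtree s) u p -> uniq (u :: p) -> size p = rdist s u (last u p).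
Proof.
elim: s u p => [|i s IHs] u p rs vu; first by case: p.
have /= /andP[vi rs'] := rs.
have [->|u_old] := eqVneq u (size s).+2.
  case: p => [|y p]; first by rewrite /= eqxx.
  rewrite [path _ _ _]/= -/(rtree (i :: s)) rtree_new // => /andP[/eqP->].
  move=> pp /andP[xp up]; rewrite path_rtree_old // in pp.
  have /(_ _ _ xp)/negbTE: forall y (q : seq nat), y \notin i :: q -> last i q != y.
    by move=> y' q; apply: contraNneq => <-; exact: mem_last.
  by rewrite /= => ->; rewrite -IHs.
have vu' : vertex s u by move: vu; rewrite vertex_cons (negbTE u_old).
case: (boolP ((size s).+2 \in p)) => [/splitPr xp|xp].
  case: xp => p1 p2; rewrite cat_path [path _ _ (_ :: _)]/= -/(rtree (i :: s)).
  rewrite [X in X && path _ _ p2]rtree_sym rtree_new // => /and3P[pp1 /eqP li pp2] up.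
  (* A vertex following the leaf would be its parent again, visited just before. *)
  have p2nil : p2 = [::].
    case: p2 pp2 up => // y p2 /=; rewrite -/(rtree (i :: s)) rtree_new // => /andP[/eqP-> _].
    rewrite -li cat_uniq /= => /and3P[ul _].
    move/and3P => [/norP[_ /norP[h _]] _ _].
    have := mem_last u p1; rewrite inE (negbTE h) orbF => /eqP h'.
    by move: ul; rewrite mem_cat inE inE h' eqxx !orbT.
  subst p2; rewrite cats1 last_rcons size_rcons eqxx.
  move: up; rewrite cats1 -[_ && _]/(uniq (u :: rcons _ _)) -rcons_cons rcons_uniq => /andP[xup up].
  by rewrite -li -IHs // -(path_rtree_old i).
move=> pp up.
have xup : (size s).+2 \notin u :: p by rewrite inE negb_or eq_sym u_old.
rewrite ifN; last by apply: contraNneq xup => <-; exact: mem_last.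
by apply: IHs => //; rewrite -(path_rtree_old i).
Qed.

Lemma rtree_path_exists s u v : rec_seq s -> vertex s u -> vertex s v ->
  exists p, [/\ path (rtree s) u p, last u p = v & uniq (u :: p)].
Proof.
elim: s u v => [|i s IHs] u v.
  by rewrite /vertex /= => _ vu vv; exists [::]; split=> //=; lia.
move=> rs; have /= /andP[vi rs'] := rs; rewrite !vertex_cons.
have notin q : path (rtree s) i q || all (vertex s) q -> (size s).+2 \notin q.
  move=> /orP[/(path_rtree_vertex rs')|] /allP h; apply/negP => /h;
  by rewrite /vertex ltnn andbF.
have [-> _|_ /= vu] := eqVneq u (size s).+2; have [-> _|_ /= vv] := eqVneq v (size s).+2.
- by exists [::].
- have [p [pp lp up]] := IHs _ _ rs' vi vv.
  have xp : (size s).+2 \notin i :: p.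
    by rewrite inE negb_or eq_sym (vertex_new vi) /= notin ?pp.
  exists (i :: p); split=> //; last by rewrite cons_uniq xp.
  by rewrite [path _ _ _]/= -/(rtree (i :: s)) rtree_new // eqxx path_rtree_old.
- have [p [pp lp up]] := IHs _ _ rs' vu vi.
  have xp : (size s).+2 \notin u :: p.
    rewrite inE negb_or eq_sym (vertex_new vu) /= notin //.
    by rewrite (path_rtree_vertex rs' pp) orbT.
  exists (rcons p (size s).+2); split; rewrite ?last_rcons //.
    rewrite rcons_path -/(rtree (i :: s)) path_rtree_old // pp lp.
    by rewrite rtree_sym rtree_new ?eqxx.
  by rewrite -[_ && _]/(uniq (u :: rcons _ _)) -rcons_cons rcons_uniq xp.
- have [p [pp lp up]] := IHs _ _ rs' vu vv.
  exists p; split=> //; rewrite -/(rtree (i :: s)) path_rtree_old //.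
  rewrite inE negb_or eq_sym (vertex_new vu) /= notin //.
  by rewrite (path_rtree_vertex rs' pp) orbT.
Qed.

Lemma dist_rtree s u v : rec_seq s -> vertex s u -> vertex s v ->
  dist (rtree s) u v = rdist s u v.
Proof.
move=> rs vu vv; rewrite /dist.
have [pp lp up] := xgetPex [::] (rtree_path_exists rs vu vv).
by rewrite (rtree_path_size rs vu pp up) lp.
Qed.

Lemma rdistxx s u : rdist s u u = 0%N.
Proof. by elim: s => //= i s ->; case: eqP. Qed.

Lemma rdist_sym s u v : rdist s u v = rdist s v u.
Proof. by elim: s u v => //= i s IHs u v; do 2 case: eqP => //; rewrite IHs. Qed.

Lemma rdist_triangle s u v w : (rdist s u w <= rdist s u v + rdist s v w)%N.
Proof.
elim: s u v w => //= i s IHs u v w.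
have := IHs i v w; have := IHs u v i; have := IHs u i w; have := IHs u v w.
by case: (u == _); case: (v == _); case: (w == _); lia.
Qed.

(** * Closeness and rank in a recursive tree *)

Lemma leq_in_count (I : eqType) (a b : pred I) (s : seq I) :
  {in s, forall x, a x -> b x} -> (count a s <= count b s)%N.
Proof.
move=> ab; rewrite (@eq_in_count _ a (fun x => (x \in s) && a x)).
  by apply: sub_count => x /andP[/ab].
by move=> x /= ->.
Qed.

Lemma closeness_rtree s v : rec_seq s -> vertex s v ->
  closeness (size s).+1 (rtree s) v
  = (\sum_(u <- iota 1 (size s).+1) rdist s v u)%N.
Proof.
move=> rs vv; rewrite /closeness big_mkcond /= big_seq [RHS]big_seq.
apply: eq_bigr => u; rewrite mem_iota => vu.
by case: eqVneq => [->|_] /=; rewrite ?rdistxx // dist_rtree.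
Qed.

(** Since ties are broken by label, [ranked_before] is antisymmetric as well as total and
    transitive, so no other vertex ranked before [v] can sit after [v] in the sorted list. *)
Lemma closeness_rank_gt n e v : (0 < v <= n)%N ->
  (count (fun u => (u != v) && ranked_before n e u v) (iota 1 n)
   < closeness_rank n e v)%N.
Proof.
move=> vv; rewrite /closeness_rank ltnS.
set r := ranked_before n e; set s := sort r _.
have rtot : total r.
  move=> x y; rewrite /r /ranked_before.
  by move: (closeness _ _ _) (closeness _ _ _) => *; lia.
have rtr : transitive r.
  move=> x y z; rewrite /r /ranked_before.
  by move: (closeness _ _ _) (closeness _ _ _) (closeness _ _ _) => *; lia.
have vs : v \in s.
  by rewrite mem_sort mem_iota; move: vv; lia.
have srt : sorted r s by apply: sort_sorted.
have us : uniq s by rewrite sort_uniq iota_uniq.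
have /seq.permP/(_ _)<- : perm_eq s (iota 1 n) by rewrite perm_sort.
case: (splitPr vs) srt us => s1 s2 srt us.
have vs1 : v \notin s1 by move: us; rewrite cat_uniq /=; case/and3P => _ /norP[].
rewrite index_cat (negbTE vs1) /= eqxx addn0 count_cat /= eqxx /= add0n.
suff /eqP-> : count (fun u => (u != v) && r u v) s2 == 0%N by rewrite addn0 count_size.
rewrite -leqn0 leqNgt -has_count; apply/hasPn => u us2.
have rvu : r v u.
  have := cat_sorted2 srt => -[_] /=; rewrite path_sortedE //.
  by case/andP => /allP/(_ _ us2).
by move: rvu; rewrite /r /ranked_before; lia.
Qed.

(** * Vertices at least as central as the root *)

Section Centroid.
Variable k : nat.

(* In a tree containing [k], these are the descendants of [k]: the vertices [v]
   for which [k] lies on the path from the root to [v]. *)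
Definition below (s : seq nat) (v : nat) : bool :=
  rdist s 1 v == (rdist s 1 k + rdist s k v)%N.

Definition level (l : nat) (s : seq nat) : nat :=
  count (fun v => below s v && (rdist s k v == l)) (iota 1 (size s).+1).

Definition outside (s : seq nat) : nat :=
  count (predC (below s)) (iota 1 (size s).+1).

(** Termwise comparison: moving from the root to [v] shortens the distance to each descendant of [k]
    by at least [t] and lengthens any other distance by at most [3t]. With at most a quarter of the
    vertices outside, the gain pays for the loss. *)
Lemma closeness_below s v t : rec_seq s -> vertex s k -> vertex s v ->
  (4 * outside s <= (size s).+1)%N -> rdist s 1 k = (2 * t)%N ->
  rdist s k v = t ->
  (closeness (size s).+1 (rtree s) v <= closeness (size s).+1 (rtree s) 1)%N.
Proof.
move=> rs vk vv out d1k dkv; rewrite !closeness_rtree //.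
suff : (\sum_(u <- iota 1 (size s).+1) (rdist s v u + t)
        <= \sum_(u <- iota 1 (size s).+1) (rdist s 1 u + 4 * t * ~~ below s u))%N.
  rewrite !big_split /= -big_distrr /= big_const_seq count_predT iter_addn_0 size_iota.
  have -> : (\sum_(u <- iota 1 (size s).+1) ~~ below s u = outside s)%N.
    by rewrite /outside -sum1_count [RHS]big_mkcond; apply: eq_bigr => u _ /=; case: below.
  by have := leq_mul (leqnn t) out; lia.
apply: leq_sum => u _.
have := rdist_triangle s v k u; have := rdist_triangle s v k 1.
have := rdist_triangle s v 1 u.
rewrite (rdist_sym s v k) (rdist_sym s k 1) d1k dkv /below d1k.
by case: eqP => /= [->|_]; lia.
Qed.

Lemma level_le_rank s t : rec_seq s -> vertex s k ->
  (4 * outside s <= (size s).+1)%N -> rdist s 1 k = (2 * t)%N -> (0 < t)%N ->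
  (level t s <= closeness_rank (size s).+1 (rtree s) 1)%N.
Proof.
move=> rs vk out d1k t0.
have := @closeness_rank_gt (size s).+1 (rtree s) 1.
move=> /(_ isT)/ltnW; apply: leq_trans.
apply: leq_in_count => v; rewrite mem_iota => vv /andP[bv /eqP dkv].
have v1 : v != 1%N.
  by apply: contraTneq bv => ->; rewrite /below rdistxx d1k; lia.
rewrite v1 /ranked_before /=.
have := closeness_below rs vk vv out d1k dkv; rewrite leq_eqVlt.
(* A tie is decided in favour of [v], whose label exceeds that of the root. *)
by case/orP => [/eqP->|->] //; rewrite eqxx; move: vv; lia.
Qed.

Lemma rdist_cons_old i s u v : vertex s u -> vertex s v ->
  rdist (i :: s) u v = rdist s u v.
Proof. by move=> vu vv /=; rewrite (vertex_new vu) (vertex_new vv). Qed.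

Lemma rdist_cons_new i s u : vertex s u ->
  rdist (i :: s) u (size s).+2 = (rdist s u i).+1.
Proof. by move=> vu /=; rewrite (vertex_new vu) eqxx. Qed.

Lemma below_cons_old i s v : vertex s k -> vertex s v ->
  below (i :: s) v = below s v.
Proof. by move=> vk vv; rewrite /below !rdist_cons_old. Qed.

Lemma below_cons_new i s : vertex s k ->
  below (i :: s) (size s).+2 = below s i.
Proof.
by move=> vk; rewrite /below !rdist_cons_new // rdist_cons_old // addnS eqSS.
Qed.

Lemma level_cons i s l : vertex s k ->
  level l (i :: s) =
  (level l s + (below s i && ((rdist s k i).+1 == l)))%N.
Proof.
move=> vk; rewrite /level (iota1S (size s).+1) count_cat.
rewrite [count _ [:: _]]/= addn0 below_cons_new // (vertex_new vk) eqxx; congr (_ + _)%N.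
apply: eq_in_count => v; rewrite mem_iota => vv.
by rewrite below_cons_old // rdist_cons_old.
Qed.

Lemma outside_cons i s : vertex s k ->
  outside (i :: s) = (outside s + ~~ below s i)%N.
Proof.
move=> vk; rewrite /outside (iota1S (size s).+1) count_cat.
rewrite [count _ [:: _]]/= addn0 below_cons_new //; congr (_ + _)%N.
by apply: eq_in_count => v; rewrite mem_iota => vv; rewrite /= below_cons_old.
Qed.
End Centroid.

(** * Averages over the random attachments *)

Lemma rev_iotaS D : rev (iota 1 D.+1) = D.+1 :: rev (iota 1 D).
Proof. by rewrite iota1S rev_cat. Qed.

Section Average.
Variable R : realType.
Implicit Types (F G : seq nat -> R) (s : seq nat).

(** Conditional expectation of [F] after one uniform attachment to the tree coded by [s]; its
    iterate [avg q] is the expectation after [q] attachments. *)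
Definition step F s : R :=
  (\sum_(i <- iota 1 (size s).+1) F (i :: s)) / (size s).+1%:R.

Definition avg q F : seq nat -> R := iter q step F.

Lemma avgS q F s : avg q.+1 F s = step (avg q F) s.
Proof. by []. Qed.

Lemma avgSr q F s : avg q.+1 F s = avg q (step F) s.
Proof. by rewrite /avg iterSr. Qed.

Lemma avgD p q F s : avg (p + q) F s = avg p (avg q F) s.
Proof. by rewrite /avg iterD. Qed.

Lemma ler_step F G s : (forall i, vertex s i -> F (i :: s) <= G (i :: s)) ->
  step F s <= step G s.
Proof.
move=> FG; rewrite ler_pM2r ?invr_gt0 ?ltr0n // big_seq [leRHS]big_seq.
by apply: ler_sum => i; rewrite mem_iota => /FG.
Qed.

(** [Q] is an invariant of growth, so [F] and [G] are compared only on lists that satisfy it and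
    have the final length. *)
Lemma ler_avg (Q : pred (seq nat)) q F G s :
  (forall i s, Q s -> vertex s i -> Q (i :: s)) -> Q s ->
  (forall s', Q s' -> size s' = (q + size s)%N -> F s' <= G s') ->
  avg q F s <= avg q G s.
Proof.
move=> Qcons; elim: q s => [|q IHq] s Qs FG; first exact: FG.
rewrite !avgS; apply: ler_step => i vi; apply: IHq => [|s' Qs' ss'].
  exact: Qcons.
by apply: FG => //; rewrite ss' /= addnS.
Qed.

Lemma eq_avg (Q : pred (seq nat)) q F G s :
  (forall i s, Q s -> vertex s i -> Q (i :: s)) -> Q s ->
  (forall s', Q s' -> size s' = (q + size s)%N -> F s' = G s') ->
  avg q F s = avg q G s.
Proof.
move=> Qcons Qs FG; apply/eqP; rewrite eq_le.
by apply/andP; split; apply: (ler_avg Qcons Qs) => s' Qs' ss'; rewrite FG.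
Qed.

Lemma step_lin a b F G s :
  step (fun s => a * F s + b * G s) s = a * step F s + b * step G s.
Proof. by rewrite /step big_split /= -!mulr_sumr; ring. Qed.

Lemma avg_lin a b q F G s :
  avg q (fun s => a * F s + b * G s) s = a * avg q F s + b * avg q G s.
Proof.
elim: q s => // q IHq s; rewrite !avgS -step_lin /step; congr (_ / _).
by apply: eq_bigr => i _; exact: IHq.
Qed.

Lemma avg_ge0 q F s : (forall s, 0 <= F s) -> 0 <= avg q F s.
Proof.
move=> F0; elim: q s => [|q IHq] s; first exact: F0.
by rewrite avgS /step divr_ge0 // sumr_ge0.
Qed.

Lemma sum_natr_count (a : pred nat) (r : seq nat) :
  \sum_(i <- r) (a i)%:R = (count a r)%:R :> R.
Proof.
by rewrite -natr_sum -sum1_count [in RHS]big_mkcond.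
Qed.

Lemma sum_iota_const (x : R) m n : \sum_(i <- iota m n) x = x * n%:R.
Proof.
by rewrite big_const_seq count_predT size_iota iter_addr_0 mulr_natr.
Qed.

Section Centroid.
Variable k : nat.

Let lev l s : R := (level k l s)%:R.
Let out s : R := (outside k s)%:R.

Lemma step_level0 s : vertex s k -> step (lev 0) s = lev 0 s.
Proof.
move=> vk; rewrite /step (eq_bigr (fun=> lev 0 s)) => [|i _].
  by rewrite sum_iota_const mulfK.
by rewrite /lev level_cons // andbF addn0.
Qed.

Lemma step_levelS l s : vertex s k ->
  step (lev l.+1) s = lev l.+1 s + lev l s / (size s).+1%:R.
Proof.
move=> vk; rewrite /step /lev.
under eq_bigr => i _ do rewrite level_cons // eqSS natrD.
rewrite big_split /= sum_natr_count sum_iota_const.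
by rewrite mulrDl mulfK.
Qed.

(** A new vertex is either below [k] or outside, so the two factors never increase together and the
    product has no cross term. *)
Lemma step_level_out l s : vertex s k ->
  step (fun s => lev l s * out s) s
  = (1 + (size s).+1%:R^-1) * (lev l s * out s)
    + (if l is l'.+1 then lev l' s * out s else 0) / (size s).+1%:R.
Proof.
move=> vk; rewrite /step.
rewrite (eq_bigr (fun i => lev l s * out s + lev l s * (~~ below k s i)%:R
  + out s * (below k s i && ((rdist s k i).+1 == l))%:R)) => [|i _]; last first.
  rewrite /lev /out level_cons // outside_cons // !natrD.
  by case: (below k s i) => /=; ring.
rewrite !big_split /= -!mulr_sumr !sum_natr_count -/(predC _) -/(outside k s).
rewrite sum_iota_const.
have n0 : (size s).+1%:R != 0 :> R by rewrite pnatr_eq0.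
case: l => [|l].
  rewrite (eq_count (a2 := pred0)) ?count_pred0 => [|i]; last by rewrite andbF.
  by rewrite /out; move: ((size s).+1%:R : R) n0 => N n0; field.
by rewrite -/(lev l s) /out; move: ((size s).+1%:R : R) n0 => N n0; field.
Qed.

Let vertexS i s : vertex s k -> vertex s i -> vertex (i :: s) k.
Proof. by rewrite /vertex /=; lia. Qed.

Lemma avg_level0 q s : vertex s k -> avg q (lev 0) s = lev 0 s.
Proof.
move=> vk; elim: q => // q IHq; rewrite avgSr -[RHS]IHq.
by apply: (eq_avg vertexS vk) => s' vk' _; exact: step_level0.
Qed.

(** The number of vertices at the last attachment is deterministic, so the one-step identity becomes
    a linear recursion between expectations. *)
Lemma avg_levelS l q s : vertex s k ->
  avg q.+1 (lev l.+1) s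
  = avg q (lev l.+1) s + avg q (lev l) s / ((size s).+1 + q)%:R.
Proof.
move=> vk; rewrite avgSr.
rewrite (eq_avg (G := fun s' => 1 * lev l.+1 s'
    + ((size s).+1 + q)%:R^-1 * lev l s') vertexS vk) => [|s' vk' ss'].
  by rewrite avg_lin mul1r [_^-1 * _]mulrC.
by rewrite step_levelS // ss' mul1r [_^-1 * _]mulrC addSn addnC.
Qed.

Lemma avg_level_ge0 l q s : 0 <= avg q (lev l) s.
Proof. by apply: avg_ge0 => s'; exact: ler0n. Qed.

(** Induction step for [avg_level_out]: [x] is the initial outside proportion, [z] and [z'] are the
    expected sizes of a level and the preceding one, [w] and [w'] the matching expected products
    with [outside]. *)
Lemma supermartingale_step (N x z z' w w' : R) : 0 < N -> 0 <= x -> 0 <= z' ->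
  w <= N * x * z -> w' <= N * x * z' ->
  (1 + N^-1) * w + N^-1 * w' <= (N + 1) * x * (z + z' / N).
Proof.
move=> N0 x0 z0 wz wz'.
have Nn0 : N != 0 by rewrite gt_eqF.
have -> : (N + 1) * x * (z + z' / N)
    = (1 + N^-1) * (N * x * z) + N^-1 * (N * x * z' + x * z').
  by field.
apply: lerD; rewrite ler_pM2l ?addr_gt0 ?invr_gt0 //.
by rewrite (le_trans wz') // lerDl mulr_ge0.
Qed.

(* A new vertex is never outside and on a level at the same time, so weighting
   by the level only slows down the martingale [outside / number of vertices]. *)
Lemma avg_level_out l q s : vertex s k ->
  avg q (fun s => lev l s * out s) s
  <= ((size s).+1 + q)%:R * (out s / (size s).+1%:R) * avg q (lev l) s.
Proof.
move=> vk; elim: q l => [|q IHq] l.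
  rewrite /avg /= addn0 [X in _ <= X * _]mulrC divfK ?pnatr_eq0 //.
  by rewrite [leRHS]mulrC lexx.
set N : R := ((size s).+1 + q)%:R in IHq *.
have N0 : 0 < N by rewrite ltr0n.
have wE : avg q.+1 (fun s => lev l s * out s) s =
    (1 + N^-1) * avg q (fun s => lev l s * out s) s
    + N^-1 * avg q (fun s => if l is l'.+1 then lev l' s * out s else 0) s.
  rewrite avgSr -avg_lin; apply: (eq_avg vertexS vk) => s' vk' ss'.
  have eN : (size s').+1 = ((size s).+1 + q)%N by rewrite ss' addSn addnC.
  by rewrite step_level_out // eN -/N [X in _ + X]mulrC.
rewrite {}wE addnS -natr1 -/N.
have out0 : 0 <= out s / (size s).+1%:R by rewrite divr_ge0 ?ler0n.
case: l => [|l]; last first.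
  by rewrite avg_levelS // supermartingale_step ?avg_level_ge0.
(* Level 0 fits the same scheme with an empty preceding level. *)
have -> : avg q.+1 (lev 0) s = avg q (lev 0) s + 0 / N.
  by rewrite mul0r addr0 !avg_level0.
apply: supermartingale_step => //; rewrite mulr0.
suff -> : avg q (fun=> 0) s = 0 by [].
rewrite (eq_avg (Q := predT) (G := fun=> 0 * 0 + 0 * 0)) // => [|s' _ _].
  by rewrite (avg_lin 0 0 q (fun=> 0) (fun=> 0)) !mul0r addr0.
by rewrite mul0r addr0.
Qed.

End Centroid.

(** * Growth of the levels and cost of the initial configuration *)

(** While the vertex count [m + q] doubles from [m * 2 ^ j], level [l.+1] receives [m * 2 ^ j]
    increments, each at least the initial [z l q] divided by the final count; together they add at
    least half of [z l q]. After scaling by [2 ^ l] this is Pascal's rule. *)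
Lemma pascal_dyadic (z : nat -> nat -> R) (m : nat) : (0 < m)%N ->
  (forall l q, 0 <= z l q) -> (forall q, z 0%N q = z 0%N 0%N) -> 1 <= z 0%N 0%N ->
  (forall l q, z l.+1 q.+1 = z l.+1 q + z l q / (m + q)%:R) ->
  forall j l q, (m * 2 ^ j <= m + q)%N -> 'C(j, l)%:R / 2 ^+ l <= z l q.
Proof.
move=> m0 z0 zc z1 zS.
have zmono l q r : z l q <= z l (q + r)%N.
  case: l => [|l]; first by rewrite zc [leRHS]zc lexx.
  elim: r => [|r IHr]; first by rewrite addn0 lexx.
  by rewrite addnS zS (le_trans IHr) // lerDl divr_ge0 ?ler0n.
have zlow l q r N : (m + q + r <= N)%N ->
    z l.+1 q + r%:R * (z l q / N%:R) <= z l.+1 (q + r)%N.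
  elim: r => [|r IHr] rN; first by rewrite mul0r addr0 addn0 lexx.
  rewrite addnS zS -natr1 mulrDl mul1r addrA lerD ?IHr //; first by lia.
  rewrite ler_pM // ?invr_ge0 ?ler0n // lef_pV2 ?posrE ?ltr0n ?ler_nat; lia.
suff zmin j l : 'C(j, l)%:R / 2 ^+ l <= z l (m * 2 ^ j - m)%N.
  move=> j l q mq; apply: le_trans (zmin j l) _.
  by rewrite -[q](subnKC (_ : m * 2 ^ j - m <= q)%N) // leq_subLR.
elim: j l => [|j IHj] [|l].
- by rewrite bin0 expr0 divr1 zc.
- by rewrite bin0n mul0r.
- by rewrite bin0 expr0 divr1 zc.
rewrite binS natrD mulrDl.
have mj : (m <= m * 2 ^ j)%N by rewrite leq_pmulr // expn_gt0.
set q := (m * 2 ^ j - m)%N in IHj *.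
have -> : (m * 2 ^ j.+1 - m)%N = (q + m * 2 ^ j)%N by rewrite /q expnS; lia.
have /(zlow l)/(le_trans _) : (m + q + m * 2 ^ j <= m * 2 ^ j * 2)%N.
  by rewrite /q; lia.
apply; apply: lerD => //.
have mj0 : (m * 2 ^ j)%:R != 0 :> R by rewrite pnatr_eq0; lia.
have -> : (m * 2 ^ j)%:R * (z l q / (m * 2 ^ j * 2)%:R) = z l q / 2.
  by rewrite [(_ * 2)%:R]natrM; move: ((m * 2 ^ j)%:R : R) mj0 => N N0; field.
by rewrite exprSr invfM mulrA ler_pM2r ?invr_gt0.
Qed.

(* [outside] stays put with probability [1 - D / m] when the [m+1]-st vertex is
   added; the falling factorials telescope. *)
Lemma avg_outside_const k D (c : R) p F s : (forall s, 0 <= F s) -> 0 <= c ->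
  vertex s k -> outside k s = D -> (D <= size s)%N -> rec_seq s ->
  (forall s', rec_seq s' -> vertex s' k -> rdist s' 1 k = rdist s 1 k ->
     level k 0 s' = level k 0 s ->
     size s' = (p + size s)%N -> outside k s' = D -> c <= F s') ->
  c * ((size s) ^_ D)%:R / ((p + size s) ^_ D)%:R <= avg p F s.
Proof.
move=> F0 c0; elim: p s => [|p IHp] s vk outD Ds rs Fc.
  rewrite mulfK; first exact: Fc.
  by rewrite pnatr_eq0 -lt0n ffact_gt0.
rewrite avgS /step ler_pdivlMr ?ltr0n //.
set x := c * ((size s).+1 ^_ D)%:R / ((p + (size s).+1) ^_ D)%:R.
(* Attachments that enlarge [outside] are discarded, as [F] is nonnegative; [(size s).+1 - D]
   parents remain. *)
apply: (@le_trans _ _ (\sum_(i <- iota 1 (size s).+1) x * (below k s i)%:R)).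
  rewrite -mulr_sumr sum_natr_count.
  have <- : ((size s).+1 - D)%N = count (below k s) (iota 1 (size s).+1).
    have := count_predC (below k s) (iota 1 (size s).+1).
    by rewrite size_iota -/(outside k s) outD; lia.
  rewrite addSnnS /x -!mulrA ler_wpM2l // mulrCA [leRHS]mulrCA.
  rewrite ler_wpM2l ?invr_ge0 ?ler0n // -!natrM ler_nat.
  by rewrite -ffactnSr ffactSS mulnC.
rewrite big_seq [leRHS]big_seq; apply: ler_sum => i; rewrite mem_iota => vi.
case: (boolP (below k s i)) => bi; last by rewrite mulr0 avg_ge0.
rewrite mulr1; apply: (IHp (i :: s)) => //=; rewrite ?(leq_trans Ds) //.
- by move: vk; rewrite /vertex /=; lia.
- by rewrite outside_cons // bi addn0.
- by rewrite rs andbT.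
move=> s' rs' vk' d1 l0 ss' out'; apply: Fc => //.
- by rewrite d1 -[RHS](rdist_cons_old i).
- by rewrite l0 level_cons // andbF addn0.
- by rewrite ss' addSnnS.
Qed.

(** Of the [D!] equally likely histories only one is kept: each vertex attaches to its predecessor,
    so the tree is the path from 1 to [D.+1]. *)
Lemma avg_single D F : (forall s, 0 <= F s) ->
  F (rev (iota 1 D)) / D`!%:R <= avg D F [::].
Proof.
elim: D F => [|D IHD] F F0; first by rewrite fact0 divr1.
have sF0 s : 0 <= step F s by exact: (@avg_ge0 1).
rewrite avgSr; apply: le_trans (IHD _ sF0).
rewrite factS natrM invfM mulrA ler_wpM2r ?invr_ge0 ?ler0n //.
rewrite /step size_rev size_iota ler_wpM2r ?invr_ge0 ?ler0n //.
rewrite rev_iotaS.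
have DI : D.+1 \in iota 1 D.+1 by rewrite mem_iota; lia.
rewrite (bigD1_seq D.+1 DI (iota_uniq _ _)) /=.
by rewrite lerDl sumr_ge0.
Qed.

End Average.

(** * The initial path *)

Lemma rec_seq_path D : rec_seq (rev (iota 1 D)).
Proof.
elim: D => // D IHD; rewrite rev_iotaS /= IHD andbT.
by rewrite /vertex size_rev size_iota; lia.
Qed.

Lemma rdist_path D v : vertex (rev (iota 1 D)) v ->
  rdist (rev (iota 1 D)) 1 v = v.-1.
Proof.
elim: D v => [|D IHD] v; first by rewrite /vertex /=; lia.
rewrite rev_iotaS; set s := rev (iota 1 D).
rewrite vertex_cons => /orP[/eqP->|vv]; last by rewrite rdist_cons_old ?IHD.
rewrite rdist_cons_new // IHD /s ?size_rev ?size_iota //.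
by rewrite /vertex size_rev size_iota; lia.
Qed.

Lemma outside_path D : outside D.+1 (rev (iota 1 D)) = D.
Proof.
rewrite /outside size_rev size_iota iota1S count_cat.
have vD : vertex (rev (iota 1 D)) D.+1 by rewrite /vertex size_rev size_iota; lia.
have bD : below D.+1 (rev (iota 1 D)) D.+1 by rewrite /below rdistxx addn0.
rewrite [count _ [:: _]]/= bD !addn0.
rewrite (@eq_in_count _ _ predT) ?count_predT ?size_iota // => v.
rewrite mem_iota => vv /=; rewrite /below !rdist_path //=; first by lia.
by rewrite /vertex size_rev size_iota; lia.
Qed.

Lemma level0_gt0 k s : vertex s k -> (0 < level k 0 s)%N.
Proof.
move=> vk; rewrite /level -has_count; apply/hasP; exists k.
  by rewrite mem_iota; move: vk; rewrite /vertex; lia.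
by rewrite /below rdistxx addn0 !eqxx.
Qed.

(** * Lower bound for the averaged rank *)

Section Rank.
Variable R : realType.

Definition rank_of_root (s : seq nat) : R :=
  (closeness_rank (size s).+1 (rtree s) 1)%:R.

(** With [n] vertices, the indicator of [4 * outside <= n] is at least [1 - 4 * outside / n], which
    makes the bound linear in [level] and [level * outside], ready for averaging. *)
Lemma rank_of_root_ge k t s : rec_seq s -> vertex s k ->
  rdist s 1 k = (2 * t)%N -> (0 < t)%N ->
  (level k t s)%:R - 4 / (size s).+1%:R * ((level k t s)%:R * (outside k s)%:R)
  <= rank_of_root s.
Proof.
move=> rs vk d1k t0.
have N0 : 0 < (size s).+1%:R :> R by rewrite ltr0n.
have -> : (level k t s)%:R
    - 4 / (size s).+1%:R * ((level k t s)%:R * (outside k s)%:R)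
  = (level k t s)%:R * (1 - 4 * (outside k s)%:R / (size s).+1%:R) :> R by ring.
have [out|out] := leqP (4 * outside k s) (size s).+1.
  rewrite (le_trans _ (_ : (level k t s)%:R <= _)) ?ler_nat ?level_le_rank //.
  by rewrite ler_piMr // gerBl divr_ge0 // mulr_ge0.
rewrite (le_trans _ (ler0n _ _)) // mulr_ge0_le0 // subr_le0.
by rewrite ler_pdivlMr // mul1r -natrM ler_nat ltnW.
Qed.

(** With at most an eighth of the vertices outside at the start, the subtracted term costs at most
    [4 * (1/8)], that is half, of the expected level. *)
Lemma avg_rank_ge k t j q s : rec_seq s -> vertex s k ->
  rdist s 1 k = (2 * t)%N -> (0 < t)%N ->
  (8 * outside k s <= (size s).+1)%N ->
  ((size s).+1 * 2 ^ j <= (size s).+1 + q)%N ->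
  'C(j, t)%:R / 2 ^+ t / 2 <= avg q rank_of_root s.
Proof.
move=> rs vk d1k t0 out jq.
pose Q s := [&& rec_seq s, vertex s k & rdist s 1 k == (2 * t)%N].
have Qcons i s' : Q s' -> vertex s' i -> Q (i :: s').
  move=> /and3P[rs' vk' d1k'] vi; rewrite /Q rdist_cons_old // d1k' andbT.
  by rewrite /= vi rs' vertex_cons vk' orbT.
have Qs : Q s by rewrite /Q rs vk d1k eqxx.
pose z := avg q (fun s => (level k t s)%:R : R) s.
have z0 : 0 <= z by exact: avg_level_ge0.
pose N : R := ((size s).+1 + q)%:R.
have N0 : 0 < N by rewrite ltr0n.
have zlow : 'C(j, t)%:R / 2 ^+ t <= z.
  apply: (@pascal_dyadic R (fun l q => avg q (fun s => (level k l s)%:R) s) (size s).+1) => //.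
  - by move=> l q'; exact: avg_level_ge0.
  - by move=> q'; exact: avg_level0.
  - by rewrite /= ler1n level0_gt0.
  - by move=> l q'; exact: avg_levelS.
apply: le_trans (_ : z / 2 <= _); first by rewrite ler_pM2r ?invr_gt0.
apply: le_trans (_ : 1 * z + (- (4 / N)) *
  avg q (fun s => (level k t s)%:R * (outside k s)%:R) s <= _); last first.
  rewrite -avg_lin; apply: (ler_avg Qcons Qs) => s' /and3P[rs' vk' /eqP d1k'] ss'.
  have -> : N = (size s').+1%:R by rewrite ss' /N addSn addnC.
  by rewrite mul1r mulNr rank_of_root_ge.
have := avg_level_out R t q vk; rewrite -/z -/N.
set w := avg q _ s => wz.
have xle : (outside k s)%:R / (size s).+1%:R <= 8^-1 :> R.
  rewrite ler_pdivrMr ?ltr0n // ler_pdivlMl // -natrM ler_nat.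
  exact: out.
rewrite mul1r mulNr lerBrDr -lerBrDl.
apply: le_trans (_ : 4 / N * (N * 8^-1 * z) <= _).
  rewrite ler_pM2l ?divr_gt0 //; apply: le_trans wz _.
  by rewrite ler_wpM2r // ler_pM2l.
have -> : 4 / N * (N * 8^-1 * z) = z / 2 by field; rewrite gt_eqF.
lra.
Qed.

(** Three phases: [D = 2t] attachments form the path, [p] more keep [outside] equal to [D] until
    there are [16t] vertices, of which [D] is exactly an eighth, and the last [q] let the levels
    grow. The costs of the first two are [1 / D!] and [D! / (16t - 1)^_D], so the factorials
    cancel. *)
Lemma avg_rank_root_ge t j n : (0 < t)%N -> (16 * t * 2 ^ j <= n.+1)%N ->
  'C(j, t)%:R / 2 ^+ t / 2 / ((16 * t).-1 ^_ (2 * t))%:R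
  <= avg n rank_of_root [::].
Proof.
move=> t0 jn.
have Mn : (16 * t <= n.+1)%N by apply: leq_trans jn; rewrite leq_pmulr ?expn_gt0.
pose D := (2 * t)%N; pose p := ((16 * t).-1 - D)%N; pose q := (n.+1 - 16 * t)%N.
have -> : n = (D + (p + q))%N by rewrite /p /q /D; lia.
set c := 'C(j, t)%:R / 2 ^+ t / 2.
have c0 : 0 <= c by rewrite !divr_ge0 // exprn_ge0.
have F0 s : 0 <= rank_of_root s by exact: ler0n.
have aF0 m s : 0 <= avg m rank_of_root s by exact: avg_ge0.
rewrite avgD; apply: le_trans (avg_single D (aF0 (p + q)%N)).
rewrite avgD ler_pdivlMr ?ltr0n ?fact_gt0 //.
have sz : size (rev (iota 1 D)) = D by rewrite size_rev size_iota.
have vD : vertex (rev (iota 1 D)) D.+1 by rewrite /vertex sz; lia.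
have := @avg_outside_const R D.+1 D c p (avg q rank_of_root) (rev (iota 1 D)).
rewrite sz ffactnn (_ : p + D = (16 * t).-1)%N; last by rewrite /p /D; lia.
rewrite mulrAC; apply => //; first exact: outside_path.
  exact: rec_seq_path.
move=> s rs vs d1 _ ss os.
apply: (avg_rank_ge (k := D.+1)) => //.
- by rewrite d1 rdist_path.
- by rewrite os ss /p /D; lia.
- apply: leq_trans (_ : 16 * t * 2 ^ j <= _)%N; first by rewrite leq_mul2r ss /p /D; lia.
  by rewrite ss /p /D /q; lia.
Qed.
End Rank.

(** * Enumeration of the possible histories *)

(** The head of the list is the only neighbour of the newest vertex, so the tree determines its
    history. *)
Lemma rtree_inj (s s' : seq nat) : size s = size s' -> rec_seq s -> rec_seq s' ->
  rtree s =2 rtree s' -> s = s'.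
Proof.
elim: s s' => [|i s IHs] [|i' s'] // [ss'] rs rs' e.
have ii' : i = i'.
  by apply/eqP; have := e (size s).+2 i; rewrite rtree_new // {1}ss' rtree_new // eqxx.
subst i'; congr (_ :: _).
have [rs1 rs1'] : rec_seq s /\ rec_seq s' by move: rs rs' => /= /andP[_ ->] /andP[_ ->].
apply: IHs => // u v.
have out s0 w : rec_seq s0 -> rtree s0 (size s0).+2 w = false.
  by move=> rs0; apply: contraTF isT => /(rtree_vertexl rs0); rewrite /vertex ltnn andbF.
have [->|un] := eqVneq u (size s).+2; first by rewrite out // ss' out.
have [->|vn] := eqVneq v (size s).+2.
  by rewrite rtree_sym out // ss' rtree_sym out.
by rewrite -(rtree_old i) // e rtree_old // -ss'.
Qed.

Fixpoint rec_seqs (n : nat) : seq (seq nat) :=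
  if n is m.+1 then [seq i :: s | s <- rec_seqs m, i <- iota 1 m.+1]
  else [:: [::]].

Lemma rec_seqsS n :
  rec_seqs n.+1 = [seq i :: s | s <- rec_seqs n, i <- iota 1 n.+1].
Proof. by []. Qed.

Lemma mem_rec_seqs n s : (s \in rec_seqs n) = (size s == n) && rec_seq s.
Proof.
elim: n s => [|n IHn] [|i s]; rewrite ?rec_seqsS //.
  by apply/negbTE/allpairsPdep => -[? [? []]].
rewrite [RHS]/= eqSS; apply/allpairsPdep/idP => [[s' [i' []]]|].
  rewrite IHn mem_iota => /andP[/eqP ss' rs'] vi' [-> ->].
  by rewrite ss' eqxx rs' /vertex ss'; lia.
case/and3P => /eqP ss vi rs; exists s, i; rewrite IHn ss eqxx rs mem_iota.
by split=> //; move: vi; rewrite /vertex ss; lia.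
Qed.

Lemma rec_seqs_uniq n : uniq (rec_seqs n).
Proof.
elim: n => // n IHn; rewrite rec_seqsS; apply: allpairs_uniq; rewrite ?iota_uniq //.
by move=> [? ?] [? ?] _ _ /= [-> ->].
Qed.

Lemma avg_rec_seqs (R : realType) n (F : seq nat -> R) :
  avg n F [::] = (\sum_(s <- rec_seqs n) F s) / n`!%:R.
Proof.
elim: n F => [|n IHn] F; first by rewrite /= big_seq1 divr1.
rewrite avgSr IHn factS natrM invfM mulrA; congr (_ / _).
rewrite rec_seqsS big_allpairs_dep mulr_suml !big_seq; apply: eq_bigr => s.
by rewrite mem_rec_seqs => /andP[/eqP ss _]; rewrite /step ss.
Qed.

(** * The law of the recursive tree *)

Section History.
Context d (Omega : measurableType d) (R : realType) (P : probability Omega R).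
Variables (T : nat -> Omega -> rel nat) (I : nat -> Omega -> nat).
Hypothesis T1 : forall w, T 1%N w =2 (fun _ _ => false).
Hypothesis hI : forall n : nat, (0 < n)%N ->
    [/\ forall w, (1 <= I n w <= n)%N,
        forall k, measurable [set w | I n w = k],
        forall k, (1 <= k <= n)%N -> P [set w | I n w = k] = (n%:R^-1)%:E,
        forall (k : nat) (t : nat -> rel nat),
          let past := [set w | forall m, (1 <= m <= n)%N -> T m w =2 t m] in
          P ([set w | I n w = k] `&` past) = (P [set w | I n w = k] * P past)%E
      & forall w, T n.+1 w =2 add_edge (T n w) (I n w) n.+1].

(** The parents observed along [w]; [n] attachments produce [T n.+1], hence the shifts by one
    below. *)
Fixpoint history (n : nat) (w : Omega) : seq nat :=
  if n is m.+1 then I m.+1 w :: history m w else [::].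

Lemma size_history n w : size (history n w) = n.
Proof. by elim: n => //= n ->. Qed.

Lemma rec_history n w : rec_seq (history n w).
Proof.
elim: n => //= n ->; rewrite andbT /vertex size_history.
by have [+ _ _ _ _] := hI (ltn0Sn n); apply.
Qed.

Lemma history_mem n w : history n w \in rec_seqs n.
Proof. by rewrite mem_rec_seqs size_history eqxx rec_history. Qed.

Lemma rtree_history n w : T n.+1 w =2 rtree (history n w).
Proof.
elim: n => [|n IHn] u v; first exact: T1.
have [_ _ _ _ ->] := hI (ltn0Sn n).
by rewrite /add_edge IHn /= size_history.
Qed.

Lemma drop_history n m w : (m <= n)%N -> drop (n - m) (history n w) = history m w.
Proof.
elim: n m => [|n IHn] m; first by rewrite leqn0 => /eqP->.
rewrite leq_eqVlt ltnS => /orP[/eqP->|mn]; first by rewrite subnn.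
by rewrite subSn //= IHn.
Qed.

(** Independence is assumed relative to the past trees, so an event on parents is put in that form.
    The [drop] leaves the [m - 1] oldest parents, which code [T m]. *)
Lemma history_past n s : size s = n -> rec_seq s ->
  [set w | history n w = s] =
  [set w | forall m, (1 <= m <= n.+1)%N -> T m w =2 rtree (drop (n.+1 - m) s)].
Proof.
move=> ss rs; apply/seteqP; split=> w /=.
  move=> <- [//|m] /andP[_ mn]; rewrite subSS drop_history //.
  exact: rtree_history.
move=> /(_ n.+1); rewrite leqnn subnn drop0 => /(_ isT) e.
apply: rtree_inj => //; rewrite ?size_history ?rec_history //.
by move=> u v; rewrite -rtree_history e.
Qed.

Lemma measurable_history n s : measurable [set w | history n w = s].
Proof.
elim: n s => [|n IHn] [|i s] /=.
- by rewrite (_ : [set _ | _] = setT) //; apply/seteqP; split.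
- by rewrite (_ : [set _ | _] = set0) //; apply/seteqP; split.
- by rewrite (_ : [set _ | _] = set0) //; apply/seteqP; split.
rewrite (_ : [set _ | _] = [set w | I n.+1 w = i] `&` [set w | history n w = s]).
  by apply: measurableI => //; have [_ + _ _ _] := hI (ltn0Sn n); apply.
by apply/seteqP; split=> w /= => [[-> ->]|[-> ->]].
Qed.

Lemma probability_history n s : size s = n -> rec_seq s ->
  P [set w | history n w = s] = (n`!%:R^-1)%:E.
Proof.
elim: n s => [|n IHn] [|i s] //=.
  move=> _ _; rewrite (_ : [set _ | _] = setT); last by apply/seteqP; split.
  by rewrite probability_setT invr1.
move=> [ss] /andP[vi rs].
rewrite (_ : [set _ | _] = [set w | I n.+1 w = i] `&` [set w | history n w = s]); last first.
  by apply/seteqP; split=> w /= => [[-> ->]|[-> ->]].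
have [_ _ Pi + _] := hI (ltn0Sn n).
rewrite (history_past ss rs) => ->; rewrite -history_past // IHn // Pi.
  by rewrite -EFinM factS natrM invfM.
by move: vi; rewrite /vertex ss.
Qed.

Lemma expectation_history n (G : seq nat -> R) : (forall s, 0 <= G s) ->
  ('E_P[fun w => G (history n w)] = (avg n G [::])%:E)%E.
Proof.
move=> G0; rewrite unlock avg_rec_seqs.
(* [history n] takes finitely many values, so the integrand is a finite sum of constants times
   indicators. *)
transitivity (\int[P]_w
    (\sum_(s <- rec_seqs n) (G s)%:E * (\1_[set w | history n w = s] w)%:E))%E.
  apply: eq_integral => w _.
  rewrite (bigD1_seq (history n w)) ?history_mem ?rec_seqs_uniq //=.
  rewrite indicE mem_set //= mule1 big1 ?adde0 // => s sw.
  rewrite indicE memNset ?mule0 //= => e; by rewrite e eqxx in sw.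
rewrite ge0_integral_sum //; last 2 first.
- move=> s; apply: measurable_funeM; apply/measurable_EFinP/measurable_indic.
  exact: measurable_history.
- by move=> s w _; rewrite mule_ge0 ?lee_fin.
rewrite mulr_suml -sumEFin !big_seq; apply: eq_bigr => s.
rewrite mem_rec_seqs => /andP[/eqP ss rs].
rewrite ge0_integralZl_EFin //; last first.
  by apply/measurable_EFinP/measurable_indic; exact: measurable_history.
rewrite integral_indic ?setIT //; last exact: measurable_history.
by rewrite EFinM; congr (_ * _)%E; exact: probability_history.
Qed.

End History.

Lemma expectation_root_rank (R : realType) (d : measure_display)
    (Omega : measurableType d) (P : probability Omega R)
    (T : nat -> Omega -> rel nat) (n : nat) : is_URRT P T ->
  ('E_P[root_rank T n.+1] = (avg n (@rank_of_root R) [::])%:E)%E.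
Proof.
move=> [T1 [I hI]].
rewrite -(expectation_history T1 hI) => [|s]; last exact: ler0n.
congr (expectation _ _); apply/funext => w.
rewrite /root_rank /rank_of_root (size_history I); congr (closeness_rank _ _ _)%:R.
by apply/funext => u; apply/funext => v; rewrite (rtree_history T1 hI).
Qed.

(** * Numerical estimates *)

Lemma leq_ffact_exp n m : (n ^_ m <= n ^ m)%N.
Proof.
rewrite ffact_prod -[X in (_ ^ X)%N]card_ord -prod_nat_const.
by apply: leq_prod => i _; exact: leq_subr.
Qed.

Lemma exp_leq_ffact n m : ((n - m) ^ m <= n ^_ m)%N.
Proof.
rewrite ffact_prod -[X in (_ ^ X)%N]card_ord -prod_nat_const.
by apply: leq_prod => i _; have := ltn_ord i; lia.
Qed.

(** For [j = 2^13 t^3], [j - t] is at least [2^12 t^3], which equals [4 * 2 * 2 * (16t)^2 * t]; the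
    lone factor 2 is bounded by [2^t] and [t!] by [t^t]. The factor [4^t] is the gain that later
    beats [e^t]. *)
Lemma binomial_dominates t : (0 < t)%N ->
  (4 ^ t * (2 ^ t * 2 * ((16 * t).-1 ^_ (2 * t))) <= 'C(2 ^ 13 * t ^ 3, t))%N.
Proof.
move=> t0; rewrite -(leq_pmul2r (fact_gt0 t)) bin_ffact -ffactnn.
apply: leq_trans (exp_leq_ffact _ _).
apply: leq_trans (_ : (2 ^ 12 * t ^ 3) ^ t <= _)%N; last first.
  rewrite leq_exp2r // (expnS 2 12) !expnS expn0 !muln1; nia.
apply: leq_trans (_ : 4 ^ t * (2 ^ t * 2 * (16 * t) ^ (2 * t)) * t ^ t <= _)%N.
  rewrite leq_mul ?leq_ffact_exp // !leq_mul2l.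
  rewrite (leq_trans (leq_ffact_exp _ _)) ?orbT //.
  by rewrite leq_exp2r ?leq_pred //; lia.
apply: leq_trans (_ : 4 ^ t * (2 ^ t * 2 ^ t * (16 * t) ^ (2 * t)) * t ^ t <= _)%N.
  by rewrite !leq_mul // -[X in (X <= _)%N]expn1 leq_exp2l.
rewrite expnM -!expnMn leq_exp2r //; lia.
Qed.

Lemma expR_nat_le (R : realType) t : expR (t%:R : R) <= 4 ^+ t.
Proof.
rewrite -[t%:R]mulr1 expRM_natl; apply: lerXn2r; rewrite ?nnegrE ?expR_ge0 //.
(* This gives [exp(1/2) <= 2], hence [e <= 4]. *)
have h : 2^-1 <= expR (- 2^-1) :> R by apply: le_trans (expR_ge1Dx _); lra.
have -> : 1 = 2^-1 + 2^-1 :> R by lra.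
rewrite expRD; have : expR 2^-1 <= 2 :> R.
  have := expRxMexpNx_1 (2^-1 : R); have := expR_ge0 (2^-1 : R); nra.
have := expR_ge0 (2^-1 : R); nra.
Qed.

Lemma expR_le_avg_rank (R : realType) t n : (0 < t)%N ->
  (16 * t * 2 ^ (2 ^ 13 * t ^ 3) <= n.+1)%N ->
  expR t%:R <= avg n (@rank_of_root R) [::].
Proof.
move=> t0 tn; apply: le_trans (avg_rank_root_ge R t0 tn).
apply: le_trans (expR_nat_le R t) _.
have f0 : (0 < (16 * t).-1 ^_ (2 * t))%N by rewrite ffact_gt0; lia.
rewrite ler_pdivlMr ?ltr0n // ler_pdivlMr // ler_pdivlMr ?exprn_gt0 //.
rewrite -!natrX -!natrM ler_nat; apply: leq_trans (binomial_dominates t0).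
by apply: eq_leq; ring.
Qed.

(** As [16t <= 2^(4 + t)] and [4 + t <= 2^13 t^3], doubling the exponent absorbs the prefactor. *)
Lemma size_condition t : (0 < t)%N ->
  (16 * t * 2 ^ (2 ^ 13 * t ^ 3) <= 2 ^ (2 ^ 14 * t ^ 3))%N.
Proof.
move=> t0.
have t3 : (t <= t ^ 3)%N by rewrite -[X in (X <= _)%N]expn1 leq_pexp2l.
have t_lt m : (16 * t * 2 ^ m <= 2 ^ (4 + t + m))%N.
  by rewrite !expnD leq_mul // leq_mul // ltnW // ltn_expl.
apply: leq_trans (t_lt _) _.
rewrite leq_exp2l // (expnS 2 13) -mulnA mul2n -addnn leq_add2r.
apply: leq_trans (_ : 2 ^ 3 * t ^ 3 <= _)%N; first by move: t3; set u := (t ^ 3)%N; lia.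
by rewrite leq_mul2r leq_exp2l ?orbT.
Qed.

(** * Choice of [t] for a given number of vertices *)

Theorem theorem32 (R : realType) (d : measure_display) (Omega : measurableType d)
    (P : probability Omega R) (T : nat -> Omega -> rel nat)
    (hT : is_URRT P T) :
  exists (c : R) (n0 : nat), 0 < c /\
    forall n : nat, (n0 <= n)%N ->
      ((expR (c * (ln (n%:R : R)) `^ (3%:R^-1)))%:E <= 'E_P[root_rank T n])%E.
Proof.
pose K : R := 2 ^+ 14.
have K0 : 0 < K by rewrite exprn_gt0.
(* The threshold gives [ln n >= K], so [a = (ln n / K)^(1/3)] is at least 1 and so is its integer
   part [t]; the factor 1/2 covers the truncation, as [a < t + 1 <= 2t]. *)
exists (K^-1 `^ 3%:R^-1 / 2), (Num.truncn (expR K)).+1.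
split; first by rewrite divr_gt0 // powR_gt0 // invr_gt0.
case=> [//|n] n0; rewrite (expectation_root_rank _ hT) lee_fin.
have n1 : 0 < n.+1%:R :> R by rewrite ltr0n.
have Kn : K <= ln n.+1%:R.
  rewrite -ler_expR lnK ?posrE //.
  apply: le_trans (ltW (Num.Theory.truncnS_gt _)) _.
  by rewrite ler_nat.
have ln0 : 0 <= ln n.+1%:R :> R by apply: le_trans Kn; exact: ltW.
pose a : R := (ln n.+1%:R / K) `^ 3%:R^-1.
have a3 : a ^+ 3 = ln n.+1%:R / K.
  by rewrite -powR_mulrn ?powR_ge0 // -powRrM mulVf // powRr1 // divr_ge0 // ltW.
have a1 : 1 <= a.
  have -> : 1 = 1 `^ 3%:R^-1 :> R by rewrite powR1.
  rewrite /a ge0_ler_powR ?nnegrE ?invr_ge0 //.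
    by rewrite divr_ge0 // ltW.
  by rewrite ler_pdivlMr // mul1r.
pose t := Num.truncn a.
have t0 : (0 < t)%N by rewrite truncn_gt0.
have /andP[ta at1] := truncn_itv (le_trans ler01 a1).
apply: le_trans (_ : expR t%:R <= _).
  rewrite ler_expR mulrAC -powRM ?invr_ge0 ?(ltW K0) // [K^-1 * _]mulrC -/a.
  have : 1 <= t%:R :> R by rewrite ler1n.
  by rewrite -natr1 in at1; move: at1; rewrite -/t; lra.
apply: expR_le_avg_rank => //.
apply: leq_trans (size_condition t0) _.
rewrite -(ler_nat R) natrX -[leRHS]lnK ?posrE //.
(* Since [2 <= e], the power of 2 is at most [exp(K * t^3)], and [K * t^3 <= K * a^3 = ln n.+1]. *)
apply: le_trans (_ : expR 1 ^+ (2 ^ 14 * t ^ 3)%N <= _).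
  apply: lerXn2r; rewrite ?nnegrE ?expR_ge0 //.
  by apply: le_trans (expR_ge1Dx _); lra.
rewrite -expRM_natl mulr1 ler_expR natrM !natrX -/K mulrC -ler_pdivlMr // -a3.
by apply: lerXn2r; rewrite ?nnegrE // powR_ge0.
Qed.
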